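(* Let $E \subseteq F_0 \subseteq F_1$ be Banach spaces with $\dim F_0/E$ finite and $F_1$ separable and atomic over $E$. Also let $G \supseteq E$ be a Gurarij space, and let $\varphi \colon F_0 \to G$ be an isometric embedding extending $\mathrm{id}_E$. Then for every $\varepsilon > 0$ there exists an isometric embedding $\psi \colon F_1 \to G$ extending $\mathrm{id}_E$ with $\| \psi|_{F_0} - \varphi \| < \varepsilon$. In particular, any separable Banach space atomic over $E$ embeds isometrically over $E$ (i.e., by an embedding extending $\mathrm{id}_E$) in any Gurarij space containing $E$.
   Context: All spaces are real; inclusions and embeddings of normed spaces are linear and isometric. Types. For a Banach space $E$ and $n \in \mathbb{N}$, let $E(n) = E \oplus \bigoplus_{i<n} \mathbb{R} x_i$, with formal variables $x_i$. The space of $n$-types $S_n(E)$ is the set of all semi-norms on $E(n)$ extending the norm of $E$; the semi-norm corresponding to $\xi \in S_n(E)$ is written $\|\cdot\|^\xi$. If $E \subseteq F$ are Banach spaces and $\bar a \in F^n$, then $\mathrm{tp}(\bar a/E) \in S_n(E)$ is the semi-norm $b + \sum \lambda_i x_i \mapsto \| b + \sum \lambda_i a_i \|$; $\bar a$ realises $\xi$ if $\xi = \mathrm{tp}(\bar a/E)$. The topology on $S_n(E)$ is the least one making $\xi \mapsto \|x\|^\xi$ continuous for every $x \in E(n)$. The distance $d(\xi,\zeta)$ is the infimum, over all Banach spaces $F \supseteq E$ and all realisations $\bar a,\bar b \in F^n$ of $\xi,\zeta$ respectively, of $\sup_i \|a_i - b_i\|$. A type $\xi$ is isolated if every metric neighbourhood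 of $\xi$ is also a neighbourhood of $\xi$ in the topology. For $E \subseteq F$, $F$ is atomic over $E$ if the type over $E$ of every finite tuple in $F$ is isolated. A Gurarij space is a Banach space $G$ such that for any $\varepsilon > 0$, finite-dimensional Banach spaces $E \subseteq F$ and isometric embedding $\varphi \colon E \to G$, there is a linear map $\psi \colon F \to G$ extending $\varphi$ with $(1-\varepsilon)\|x\| \leq \|\psi x\| \leq (1+\varepsilon)\|x\|$ for all $x \in F$. *)

(* Defs.v *)
From HB Require Import structures.
From mathcomp Require Import all_boot all_order all_algebra.
From mathcomp Require Import all_classical all_reals all_analysis.

Set Implicit Arguments.
Unset Strict Implicit.
Unset Printing Implicit Defensive.

Import Order.TTheory GRing.Theory Num.Theory.
Import numFieldNormedType.Exports.

Local Open Scope classical_set_scope.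
Local Open Scope ring_scope.

(* An inclusion E ⊆ F of Banach spaces is rendered by an [isoemb E F]. *)
Record isoemb (R : realType) (E F : normedModType R) := IsoEmb {
  isoemb_linear :> {linear E -> F} ;
  isoemb_norm : forall x : E, `|isoemb_linear x| = `|x| }.

Section IsoembComp.
Variables (R : realType) (E F G : normedModType R).
Variables (j : isoemb F G) (i : isoemb E F).

Lemma isoemb_comp_norm (x : E) : `|(j \o i) x| = `|x|.
Proof. by rewrite /= !isoemb_norm. Qed.

Definition isoemb_comp : isoemb E G :=
  @IsoEmb R E G (j \o i : {linear E -> G}) isoemb_comp_norm.

End IsoembComp.

Section FiniteDimension.
Variable R : realType.

Definition finite_dimensional (E : normedModType R) : Prop :=
  exists (n : nat) (a : 'I_n -> E),
    forall x : E, exists c : 'I_n -> R, x = \sum_(k < n) c k *: a k.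

(* The quotient F / E has finite dimension: it is spanned by the cosets of
   finitely many a k. *)
Definition finite_codimensional (E F : normedModType R) (i : isoemb E F) :
    Prop :=
  exists (n : nat) (a : 'I_n -> F),
    forall x : F, exists (e : E) (c : 'I_n -> R),
      x = i e + \sum_(k < n) c k *: a k.

End FiniteDimension.

Definition separable_space (T : topologicalType) : Prop :=
  exists2 D : set T, countable D & dense D.

(* Operator norm, meant for linear f; +oo if f is unbounded. *)
Definition opnorm (R : realType) (E F : normedModType R) (f : E -> F) :
    \bar R :=
  ereal_sup [set `|f x|%:E | x in [set x : E | `|x| <= 1]].

(* E(n) is E * 'rV[R]_n: the pair (b, l) stands for b + \sum_k l_k x_k. *)
Record ntype (R : realType) (E : normedModType R) (n : nat) := NType {
  tnorm :> E * 'rV[R]_n -> R ;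
  tnormD : forall u v, tnorm (u + v) <= tnorm u + tnorm v ;
  tnormZ : forall (r : R) u, tnorm (r *: u) = `|r| * tnorm u ;
  tnormE : forall b : E, tnorm (b, 0) = `|b| }.

HB.instance Definition _ (R : realType) (E : normedModType R) (n : nat) :=
  gen_eqMixin (ntype E n).
HB.instance Definition _ (R : realType) (E : normedModType R) (n : nat) :=
  gen_choiceMixin (ntype E n).

(* Least topology making all the evaluations xi |-> tnorm xi u continuous. *)
HB.instance Definition _ (R : realType) (E : normedModType R) (n : nat) :=
  Topological.copy (ntype E n)
    (sup_topology (fun u : E * 'rV[R]_n =>
       Topological.class
         (initial_topology (fun xi : ntype E n => tnorm xi u : R)))).

Section TypeOfTuple.
Variables (R : realType) (E F : normedModType R) (i : isoemb E F).
Variables (n : nat) (a : 'I_n -> F).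

Definition tp_norm (u : E * 'rV[R]_n) : R :=
  `|i u.1 + \sum_(k < n) u.2 ord0 k *: a k|.

Lemma tp_normD u v : tp_norm (u + v) <= tp_norm u + tp_norm v.
Proof.
rewrite /tp_norm /= linearD; under eq_bigr do rewrite mxE scalerDl.
by rewrite big_split /= addrACA ler_normD.
Qed.

Lemma tp_normZ (r : R) u : tp_norm (r *: u) = `|r| * tp_norm u.
Proof.
rewrite /tp_norm /= linearZ; under eq_bigr do rewrite mxE -scalerA.
by rewrite -scaler_sumr /= -scalerDr normrZ.
Qed.

Lemma tp_normE (b : E) : tp_norm (b, 0) = `|b|.
Proof.
rewrite /tp_norm /= big1 ?addr0 ?isoemb_norm // => k _.
by rewrite mxE scale0r.
Qed.

Definition tp : ntype E n := NType tp_normD tp_normZ tp_normE.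

Definition realises (xi : ntype E n) : Prop := xi = tp.

End TypeOfTuple.

(* As types are always realised jointly in some F, the infimum is finite; over
   an empty family it would be +oo. *)
Definition type_dist (R : realType) (E : completeNormedModType R) (n : nat)
    (xi zeta : ntype E n) : \bar R :=
  ereal_inf [set r | exists (F : completeNormedModType R) (i : isoemb E F)
      (a b : 'I_n -> F),
    [/\ realises i a xi, realises i b zeta &
        r = (\big[Num.max/0]_(k < n) `|a k - b k|)%:E]].

Definition metric_nbhs (R : realType) (E : completeNormedModType R) (n : nat)
    (xi : ntype E n) (A : set (ntype E n)) : Prop :=
  exists2 r : R, 0 < r & [set zeta | (type_dist xi zeta < r%:E)%E] `<=` A.

Definition isolated_type (R : realType) (E : completeNormedModType R)
    (n : nat) (xi : ntype E n) : Prop :=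
  forall A : set (ntype E n), metric_nbhs xi A -> nbhs xi A.

Definition atomic_over (R : realType) (E F : completeNormedModType R)
    (i : isoemb E F) : Prop :=
  forall (n : nat) (a : 'I_n -> F), isolated_type (tp i a).

Definition gurarij (R : realType) (G : completeNormedModType R) : Prop :=
  forall (eps : R) (E F : completeNormedModType R) (i : isoemb E F)
    (phi : isoemb E G),
    0 < eps -> finite_dimensional E -> finite_dimensional F ->
    exists psi : {linear F -> G},
      (forall x : E, psi (i x) = phi x) /\
      (forall x : F, (1 - eps) * `|x| <= `|psi x| <= (1 + eps) * `|x|).

(* Main.v *)
Require Import Defs.
From HB Require Import structures.
From mathcomp Require Import all_boot all_order all_algebra.
From mathcomp Require Import all_classical all_reals all_analysis.
From mathcomp Require Import ring lra.
Set Implicit Arguments.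
Unset Strict Implicit.
Unset Printing Implicit Defensive.
Import Order.TTheory GRing.Theory Num.Theory.
Import numFieldNormedType.Exports.
Local Open Scope classical_set_scope.
Local Open Scope ring_scope.

(** The type over [E] of a tuple [a] of [F] is the norm of [tuple_value i a u]
    as a function of [u], so two tuples [a] of [F] and [b] of [G] are at
    distance at most [r] in the sense of types exactly when the norms of
    [tuple_value i a u] and [tuple_value k b u] never differ by more than [r *
    l1norm u.2] ([type_close]). The embedding is obtained by approximating
    longer and longer tuples of [F] by tuples of [G], better and better.

    The engine is [extend_approx]. Let [b] in [G] be [r]-close to [a], and let
    [a'] be a longer tuple of [F]. Gluing [F] to [G] by identifying the two
    copies of [E] exactly, and [a] with [b] up to [r], gives a space that
    contains [G] isometrically, in which [a'] has a type over [G]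
    ([amalgam_type]) that puts its first terms within [r] of [b]. The Gurarij
    property realises this type in [G] up to an arbitrarily small error, as long
    as only finitely many elements of [E] matter ([gurarij_approx]): so some
    tuple [b'] of [G] moves [b] by at most [2 * r], and its type over [E] is as
    near as desired to that of [a'] at finitely many vectors. Since the type of
    [a'] is isolated, nearness at suitable finitely many vectors already means
    metric nearness, for any prescribed bound ([atomic_approx]); hence [b'] is
    [r']-close to [a'] for an [r'] chosen in advance.

    Now let the tuples exhaust a sequence that is dense in [F] and let the
    bounds be [r / 2 ^+ m]. Each coordinate moves by a summable amount, so it
    converges, and the limits have exactly the type of the dense sequence
    ([limit_isometry]). They therefore define an isometry on a dense subspace,
    which extends to [F] ([isometric_extension]), and which moves the initial
    tuple by at most [4 * r].

    For the norm estimate on [F0], take as initial tuple a finite family that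
    spans [F0] over [E], with the exact copy that [phi] provides. Smallness on
    this family implies smallness in operator norm because vectors of [F0] have
    coefficients bounded by a multiple of their norm
    ([finite_codimensional_coef]); this rests on the fact that adding finitely
    many vectors to a complete subspace keeps it complete ([complete_span_sum]).
    The same fact shows that finite-dimensional normed spaces are complete,
    which is needed to feed the Gurarij property. The second half of the theorem
    is the case of the empty initial tuple. *)

(** * Complete subspaces and finite families of vectors *)

Section CompleteSubspaces.
Variables (R : realType) (X : normedModType R).

Definition is_subspace (Y : set X) : Prop :=
  Y 0 /\ forall (r : R) x y, Y x -> Y y -> Y (r *: x + y).

(** Completeness is a property of [Y] and not of the ambient space, so that it
    can be proved for the finite-dimensional normed spaces built below. *)
Definition complete_subset (Y : set X) : Prop :=
  forall F : set_system X, ProperFilter F -> cauchy F -> F Y ->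
    exists2 l, Y l & F --> l.

Definition line_sum (Y : set X) (a : X) : set X :=
  [set z | exists t : R, Y (z - t *: a)].

Lemma lipschitz_cauchy (X' : normedModType R) (f : X -> X') (Z : set X)
    (C : R) (F : set_system X) : ProperFilter F -> cauchy F -> F Z ->
  (forall x y, Z x -> Z y -> `|f x - f y| <= C * `|x - y|) ->
  cauchy (f @ F).
Proof.
move=> FF cF FZ fC; apply/cauchy_exP => e e0.
have C0 : 0 < `|C| + 1 by rewrite ltr_wpDl.
have e'0 : 0 < e / (`|C| + 1) / 2 by rewrite !divr_gt0.
have /cauchyP /(_ _ e'0)[x Fx] := cF.
have FxZ : F (ball x (e / (`|C| + 1) / 2) `&` Z) by apply: filterI.
have [x0 [/= xx0 Zx0]] := @filter_ex _ F _ _ FxZ.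
exists (f x0); apply: filterS FxZ => y [xy Zy] /=.
move: xx0 xy; rewrite -!ball_normE /= => xx0 xy.
have d : `|x0 - y| < e / (`|C| + 1).
  rewrite -[x0](subrK x) -addrA (le_lt_trans (ler_normD _ _)) // distrC.
  by rewrite (splitr (e / _)) ltrD.
apply: le_lt_trans (fC _ _ Zx0 Zy) _; move: d; rewrite ltr_pdivlMr //.
apply: le_lt_trans; rewrite mulrC ler_wpM2l //.
by rewrite (le_trans (ler_norm _)) // lerDl.
Qed.

(** Otherwise the trace on [Y] of the neighbourhoods of [a] would be a Cauchy
    filter, whose limit in [Y] can only be [a]. *)
Lemma subspace_dist_gt0 (Y : set X) (a : X) : complete_subset Y -> ~ Y a ->
  exists2 d : R, 0 < d & forall y, Y y -> d <= `|a - y|.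
Proof.
move=> cY nYa; apply: contrapT => H; apply: nYa.
have cla : closure Y a.
  move=> B /nbhs_ballP[e /= e0 aB]; apply: contrapT => H'; apply: H.
  exists e => // y Yy; rewrite leNgt; apply/negP => ye; apply: H'.
  by exists y; split => //; apply: aB; rewrite -ball_normE.
have FF : ProperFilter (within Y (nbhs a)) by apply: within_nbhs_proper.
have Fa : within Y (nbhs a) --> a by apply: cvg_within.
have [||l Yl Fl] := cY _ FF; first by apply: cvg_cauchy; exact: cvgP Fa.
  by rewrite /within /=; near=> y.
suff <- : l = a by [].
exact: cvg_unique Fl Fa.
Unshelve. all: by end_near. Qed.

(** If [a] lies outside [Y], at distance at least [d] from it, then [d * `|t| <=
    `|y + t *: a|]: the coefficient along [a], and hence also the component in
    [Y], depend on the vector in a Lipschitz way, and completeness passes from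
    the line and from [Y] to their sum. *)
Lemma complete_line_sum (Y : set X) (a : X) :
    is_subspace Y -> complete_subset Y ->
  [/\ is_subspace (line_sum Y a), complete_subset (line_sum Y a) &
    exists2 C : R, 0 <= C & forall z, line_sum Y a z ->
      exists2 t : R, Y (z - t *: a) & `|t| <= C * `|z|].
Proof.
move=> [Y0 YD] cY.
have sY : is_subspace (line_sum Y a).
  split; first by exists 0; rewrite scale0r subr0.
  move=> r x y [t Yt] [u Yu]; exists (r * t + u).
  have -> : r *: x + y - (r * t + u) *: a = r *: (x - t *: a) + (y - u *: a).
    by rewrite scalerBr scalerA scalerDl opprD addrACA.
  exact: YD.
have [Ya|nYa] := pselect (Y a).
  have -> : line_sum Y a = Y.
    apply/seteqP; split => z /=; last first.
      by move=> Yz; exists 0; rewrite ?scale0r ?subr0.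
    by case=> t Yt; rewrite -(subrK (t *: a) z) addrC; apply: YD.
  split => //; exists 0 => // z Yz.
  by exists 0; rewrite ?normr0 ?mul0r // scale0r subr0.
have [d d0 dY] := subspace_dist_gt0 cY nYa.
have tbound z t : Y (z - t *: a) -> `|t| <= d^-1 * `|z|.
  move=> Yt; have [->|t0] := eqVneq t 0.
    by rewrite normr0 mulr_ge0 // invr_ge0 ltW.
  rewrite mulrC ler_pdivlMr // mulrC.
  have Yt' : Y (- t^-1 *: (z - t *: a)).
    by rewrite -[_ *: _]addr0; apply: YD.
  have := dY _ Yt'; rewrite scaleNr opprK scalerBr scalerA mulVf // scale1r.
  rewrite addrC subrK normrZ normfV => h.
  by rewrite -ler_pdivlMr ?normr_gt0 // mulrC.
have ex z : exists t, line_sum Y a z -> Y (z - t *: a).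
  by have [[t h]|n] := pselect (line_sum Y a z); [exists t|exists 0].
have [t tP] := choice ex.
have tL z z' : line_sum Y a z -> line_sum Y a z' ->
    `|t z - t z'| <= d^-1 * `|z - z'|.
  move=> /tP Yz /tP Yz'; apply: tbound.
  have -> : z - z' - (t z - t z') *: a =
      -1 *: (z' - t z' *: a) + (z - t z *: a).
    rewrite scaleN1r scalerBl !opprB [RHS]addrC addrACA [RHS]addrACA.
    by rewrite [- z' + _]addrC.
  exact: YD.
split => //; last first.
  exists d^-1; first by rewrite invr_ge0 ltW.
  by move=> z /tP Yz; exists (t z) => //; apply: tbound.
move=> F FF cF FYa.
have ct := @lipschitz_cauchy R^o t _ _ _ FF cF FYa tL.
have /cvg_ex[t0 tt0] : cvg ((t : X -> R^o) @ F) by apply: cauchy_cvg.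
pose y z := z - t z *: a.
have cy : cauchy (y @ F).
  apply: (@lipschitz_cauchy X y _ (1 + d^-1 * `|a|) _ FF cF FYa) => z z' hz hz'.
  have -> : y z - y z' = (z - z') - (t z - t z') *: a.
    rewrite /y scalerBl !opprB addrACA [RHS]addrACA.
    by rewrite [- (t z *: a) + _]addrC.
  rewrite mulrDl mul1r (le_trans (ler_normB _ _)) // lerD2l normrZ mulrAC.
  by rewrite ler_wpM2r // tL.
have FyY : F (y @^-1` Y) by apply: filterS FYa => z /tP.
have [y0 Yy0 yy0] := cY _ _ cy FyY.
exists (y0 + t0 *: a).
  by exists t0; rewrite addrK.
have -> : F = (id @ F) :> set_system X by apply/seteqP; split.
have -> : id = (fun z => y z + t z *: a) by apply/funext => z; rewrite /y subrK.
apply: cvgD => //; apply: cvgZr_tmp => //; exact: tt0.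
Qed.

End CompleteSubspaces.

Section SpanSum.
Variables (R : realType) (X : normedModType R).

(** Adding the vectors one at a time makes [complete_line_sum] the inductive
    step. *)
Fixpoint span_sum (Y : set X) (a : nat -> X) (n : nat) : set X :=
  if n is m.+1 then line_sum (span_sum Y a m) (a m) else Y.

Lemma span_sumI (Y : set X) (a : nat -> X) (n : nat) z (c : nat -> R) :
  Y (z - \sum_(l < n) c l *: a l) -> span_sum Y a n z.
Proof.
elim: n z => [|n IH] z /=; first by rewrite big_ord0 subr0.
rewrite big_ord_recr /= => h; exists (c n); apply: IH.
by rewrite addrAC -addrA -opprD.
Qed.

(** When the [a l] are dependent modulo [Y] the coefficients are a choice;
    giving coefficient [0] to a vector that already lies in the previous sum
    keeps them bounded. *)
Lemma complete_span_sum (Y : set X) (a : nat -> X) (n : nat) :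
    is_subspace Y -> complete_subset Y ->
  [/\ is_subspace (span_sum Y a n), complete_subset (span_sum Y a n) &
    exists2 C : R, 0 <= C & forall z, span_sum Y a n z ->
      exists2 c : nat -> R, Y (z - \sum_(l < n) c l *: a l) &
        forall l, (l < n)%N -> `|c l| <= C * `|z|].
Proof.
move=> sY cY; elim: n => [|n [sYn cYn [C C0 HC]]] /=.
  split => //; exists 0 => // z Yz; exists (fun=> 0) => //.
  by rewrite big_ord0 subr0.
have [sYn1 cYn1 [D D0 HD]] := complete_line_sum (a n) sYn cYn.
(* [D] bounds the new coefficient [t]; the others are coefficients of [z - t *:
   a n], whose norm is at most [(1 + D * `|a n|) * `|z|]. *)
split => //; exists (D + C * (1 + D * `|a n|)).
  by rewrite addr_ge0 // mulr_ge0 // addr_ge0 // mulr_ge0.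
move=> z /HD [t /HC [c Yc cC] tD].
exists (fun l => if l == n then t else c l).
  rewrite big_ord_recr /= eqxx.
  under eq_bigr => l _ do rewrite (ltn_eqF (ltn_ord l)).
  by rewrite [_ + t *: _]addrC opprD addrA.
move=> l; rewrite ltnS leq_eqVlt mulrDl; case: (eqVneq l n) => [_ _|_ /= ln].
  by rewrite (le_trans tD) // lerDl !mulr_ge0 // addr_ge0 // mulr_ge0.
apply: le_trans (cC _ ln) _.
apply: (@le_trans _ _ (C * (1 + D * `|a n|) * `|z|)).
  rewrite -mulrA ler_wpM2l // mulrDl mul1r (le_trans (ler_normB _ _)) // lerD2l.
  by rewrite normrZ mulrAC ler_wpM2r.
by rewrite lerDr mulr_ge0.
Qed.

Lemma complete_range (E : completeNormedModType R) (i : isoemb E X) :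
  is_subspace (range i) /\ complete_subset (range i).
Proof.
split; first split.
- by exists 0 => //; rewrite linear0.
- by move=> r _ _ [x _ <-] [y _ <-]; exists (r *: x + y) => //; rewrite linearP.
move=> F FF cF Fi.
have ex x : exists e, range i x -> i e = x.
  by have [[e _ <-]|n] := pselect (range i x); [exists e|exists 0].
have [f fP] := choice ex.
have cf : cauchy (f @ F).
  apply: (@lipschitz_cauchy _ _ _ f _ 1 _ FF cF Fi) => x y hx hy.
  by rewrite -(isoemb_norm i) linearB !fP // mul1r.
have /cvg_ex[e fe] : cvg (f @ F) by apply: cauchy_cvg.
exists (i e); first by exists e.
apply/cvgrPdist_lt => eps eps0.
have /cvgrPdist_lt /(_ _ eps0) := fe.
apply: filterS2 Fi => x /fP xE.
by rewrite -[in X in _ -> X]xE -linearB isoemb_norm.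
Qed.

Lemma complete_set0 : is_subspace [set 0 : X] /\ complete_subset [set 0 : X].
Proof.
split; first by split => // r x y -> ->; rewrite scaler0 addr0.
move=> F FF cF F0; exists 0 => //.
apply/cvgrPdist_lt => e e0; apply: filterS F0 => x ->.
by rewrite subrr normr0.
Qed.

End SpanSum.

(** * Norms on row vectors give finite-dimensional Banach spaces *)

Record rVnorm (R : realType) (p : nat) := RVNorm {
  rvnorm :> 'rV[R]_p -> R ;
  rvnormD : forall u v, rvnorm (u + v) <= rvnorm u + rvnorm v ;
  rvnormZ : forall (r : R) u, rvnorm (r *: u) = `|r| * rvnorm u ;
  rvnorm0 : forall u, rvnorm u = 0 -> u = 0 }.

(** A copy of ['rV_p] in which the norm [N] replaces the supremum norm that row
    vectors carry by default. *)
Definition rV_of (R : realType) (p : nat) (N : rVnorm R p) : Type := 'rV[R]_p.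

HB.instance Definition _ (R : realType) (p : nat) (N : rVnorm R p) :=
  GRing.Lmodule.copy (rV_of N) 'rV[R]_p.
HB.instance Definition _ (R : realType) (p : nat) (N : rVnorm R p) :=
  Lmodule_isNormed.Build R (rV_of N)
    (@rvnormD _ _ N) (@rvnormZ _ _ N) (@rvnorm0 _ _ N).

Section RVOf.
Variables (R : realType) (p : nat) (N : rVnorm R p).

Lemma rV_of_span (z : rV_of N) :
  z = \sum_(l < p) (z : 'rV_p) ord0 l *: (delta_mx 0 l : rV_of N).
Proof. exact: (row_sum_delta (z : 'rV_p)). Qed.

Lemma rV_of_finite_dimensional : finite_dimensional (rV_of N).
Proof.
exists p, (fun l => delta_mx 0 l : rV_of N) => x.
by exists (fun l => (x : 'rV_p) ord0 l); exact: rV_of_span.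
Qed.

(** The whole space is obtained from the zero subspace by adding the unit
    vectors. *)
Lemma rV_of_complete (F : set_system (rV_of N)) :
  ProperFilter F -> cauchy F -> cvg F.
Proof.
move=> FF cF.
pose a (l : nat) : rV_of N := \row_(j < p) (j == l :> nat)%:R.
have [s0 c0] := complete_set0 (rV_of N).
have [_ cp _] := complete_span_sum a p s0 c0.
suff Fp : F (span_sum [set 0] a p).
  by have [l _ Fl] := cp F FF cF Fp; apply/cvg_ex; exists l.
apply: filterS filterT => z _.
pose c (l : nat) := if insub l is Some i then (z : 'rV_p) ord0 i else 0.
apply: (@span_sumI _ _ _ _ _ _ c) => /=.
apply/eqP; rewrite subr_eq0; apply/eqP.
rewrite [LHS]rV_of_span; apply: eq_bigr => l _; congr (_ *: _).
  by rewrite /c valK.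
by apply/rowP => j; rewrite !mxE.
Qed.

HB.instance Definition _ := Uniform_isComplete.Build (rV_of N) rV_of_complete.

End RVOf.

(** * Approximate realisation of types in Gurarij spaces *)

Section LinOf.
Variables (R : pzRingType) (U V : lmodType R) (f : U -> V).

(** Turns a proof of linearity local to a proof script into a [{linear _ -> _}]
    structure. *)
Definition lin_of (h : linear f) : U -> V := f.

HB.instance Definition _ (h : linear f) :=
  GRing.isLinear.Build R U V *:%R (lin_of h) h.

End LinOf.

(** The rows of [B] are coordinates of a basis of the image of [P]. As long as
    [P] kills some [c] with [c ord0 i != 0], the [i]-th coordinate can be
    eliminated without changing the image. *)
Lemma linear_basis (R : fieldType) (M : lmodType R) (p : nat)
    (P : {linear 'rV[R]_p -> M}) :
  exists (q : nat) (B : 'M[R]_(q, p)),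
    (forall d, P (d *m B) = 0 -> d = 0) /\
    (forall c, exists d, P (d *m B) = P c).
Proof.
elim: p P => [|p IH] P.
  exists 0, 1%:M; split=> [d _|c]; first by rewrite [d]thinmx0.
  by exists c; rewrite mulmx1.
have [inj|] := pselect (forall c, P c = 0 -> c = 0).
  exists p.+1, 1%:M; split=> [d|c]; first by rewrite mulmx1; apply: inj.
  by exists c; rewrite mulmx1.
move=> /existsNP[c /not_implyP[Pc /eqP/rV0Pn[i ci]]].
(* Every vector is congruent modulo [c] to one whose [i]-th entry vanishes. *)
have [q [B [injB surjB]]] := IH (P \o mulmxr (row' i 1%:M)).
exists q, (B *m row' i 1%:M); split=> [d|c'].
  by rewrite mulmxA; apply: injB.
pose e := c' - (c' ord0 i / c ord0 i) *: c.
have Pe : P e = P c' by rewrite linearB linearZ /= Pc scaler0 subr0.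
have [d dE] := surjB (col' i e); exists d.
rewrite mulmxA -Pe; move: dE => /= ->; congr (P _).
apply/rowP => j; rewrite mxE; case: (unliftP i j) => [k|] ->.
  rewrite (bigD1 k) //= !mxE eqxx mulr1 big1 ?addr0 // => l lk.
  by rewrite !mxE (inj_eq lift_inj) (negbTE lk) mulr0.
rewrite big1 => [|l _]; first by rewrite !mxE divfK // subrr.
by rewrite !mxE eq_sym (negbTE (neq_lift _ _)) mulr0.
Qed.

Section L1Norm.
Variables (R : realType) (n : nat).

Definition l1norm (l : 'rV[R]_n) : R := \sum_(k < n) `|l ord0 k|.

Lemma l1norm_ge0 l : 0 <= l1norm l.
Proof. exact: sumr_ge0. Qed.

Lemma l1normD u v : l1norm (u + v) <= l1norm u + l1norm v.
Proof.
by rewrite -big_split; apply: ler_sum => k _; rewrite mxE ler_normD.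
Qed.

Lemma l1normZ (r : R) u : l1norm (r *: u) = `|r| * l1norm u.
Proof. by rewrite mulr_sumr; apply: eq_bigr => k _; rewrite mxE normrM. Qed.

Lemma l1norm0 : l1norm 0 = 0.
Proof. by apply: big1 => k _; rewrite mxE normr0. Qed.

Lemma l1norm_eq0 u : l1norm u = 0 -> u = 0.
Proof.
move=> /eqP; rewrite psumr_eq0 // => /allP h; apply/rowP => k; rewrite mxE.
by apply/eqP; rewrite -normr_eq0; apply: h; rewrite mem_index_enum.
Qed.

Lemma l1norm_delta k : l1norm (delta_mx 0 k) = 1.
Proof.
rewrite /l1norm (bigD1 k) //= big1 => [|j jk].
  by rewrite mxE !eqxx normr1 addr0.
by rewrite mxE (negbTE jk) andbF normr0.
Qed.

End L1Norm.

Lemma ntype_ge0 (R : realType) (E : normedModType R) n (xi : ntype E n) u :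
  0 <= xi u.
Proof.
have h : xi 0 = 0 by rewrite -(scale0r 0) tnormZ normr0 mul0r.
have := tnormD xi u (-1 *: u).
by rewrite scaleN1r subrr h -scaleN1r tnormZ normrN1 mul1r -mulr2n pmulrn_lge0.
Qed.

(** The types over [G] of tuples of [G] are dense, even uniformly over a
    finite-dimensional subspace of [G], here the image of [P]. The extension of
    finite-dimensional spaces to which the Gurarij property applies is that
    image, in coordinates with respect to a basis, followed by formal variables
    carrying the seminorm [xi]. Being only a seminorm, [xi] may vanish on
    nonzero combinations of the variables: the term [eta * l1norm l] turns it
    into a norm and leaves the norm of [G] unchanged. *)
Lemma gurarij_approx (R : realType) (G : completeNormedModType R)
    (m : nat) (xi : ntype G m) (p : nat) (P : {linear 'rV[R]_p -> G})
    (eta : R) :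
  gurarij G -> 0 < eta ->
  exists b : 'I_m -> G, forall c l,
    (1 - eta) * xi (P c, l) <= `|P c + \sum_(k < m) l ord0 k *: b k| <=
    (1 + eta) * (xi (P c, l) + eta * l1norm l).
Proof.
move=> gG eta0; have [q [B [injB surjB]]] := linear_basis P.
pose nV d := `|P (d *m B)|.
have nVD u v : nV (u + v) <= nV u + nV v.
  by rewrite /nV mulmxDl linearD ler_normD.
have nVZ r u : nV (r *: u) = `|r| * nV u.
  by rewrite /nV -scalemxAl linearZ normrZ.
have nV0 u : nV u = 0 -> u = 0.
  by move=> /normr0_eq0; apply: injB.
pose NV := RVNorm nVD nVZ nV0.
pose nW (w : 'rV_(q + m)) :=
  xi (P (lsubmx w *m B), rsubmx w) + eta * l1norm (rsubmx w).
have nWD u v : nW (u + v) <= nW u + nW v.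
  rewrite /nW !linearD mulmxDl linearD /= addrACA -mulrDr lerD //.
    exact: (tnormD xi (_, _) (_, _)).
  by rewrite ler_wpM2l ?l1normD // ltW.
have nWZ r u : nW (r *: u) = `|r| * nW u.
  rewrite /nW !linearZ -scalemxAl linearZ /= l1normZ mulrCA mulrDr.
  by rewrite -(tnormZ xi _ (_, _)).
have nW0 u : nW u = 0 -> u = 0.
  move=> /eqP; rewrite /nW paddr_eq0 ?ntype_ge0 //; last first.
    by rewrite mulr_ge0 ?l1norm_ge0 // ltW.
  case/andP=> /eqP h; rewrite mulf_eq0 gt_eqF //= => /eqP /l1norm_eq0 u2.
  move: h; rewrite u2 tnormE => /normr0_eq0 /injB u1.
  by rewrite -[u]hsubmxK u1 u2 row_mx0.
pose NW := RVNorm nWD nWZ nW0.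
pose inc (d : rV_of NV) : rV_of NW := row_mx d 0.
have inc_lin : linear inc.
  by move=> r u v; rewrite /inc scale_row_mx add_row_mx scaler0 addr0.
have inc_norm d : `|lin_of inc_lin d| = `|d|.
  rewrite -[LHS]/(nW (row_mx d 0)) -[RHS]/(nV d) /nW row_mxKl row_mxKr.
  by rewrite l1norm0 mulr0 addr0 tnormE.
pose phi (d : rV_of NV) : G := P (d *m B).
have phi_lin : linear phi.
  by move=> r u v; rewrite /phi mulmxDl -scalemxAl linearP.
have phi_norm d : `|lin_of phi_lin d| = `|d| by [].
have [psi [psiE psiN]] := gG eta _ _ (IsoEmb inc_norm) (IsoEmb phi_norm) eta0
  (rV_of_finite_dimensional NV) (rV_of_finite_dimensional NW).
pose b k := psi (row_mx 0 (delta_mx 0 k) : rV_of NW).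
exists b => c l; have [d dE] := surjB c.
have row_mxE : row_mx d l = row_mx d 0 +
    \sum_(k < m) l ord0 k *: (row_mx 0 (delta_mx 0 k) : 'rV_(q + m)).
  rewrite -[RHS]hsubmxK !linearD /= !linear_sum row_mxKl row_mxKr.
  congr row_mx.
    by rewrite big1 ?addr0 // => k _; rewrite linearZ /= row_mxKl scaler0.
  rewrite add0r {1}[l]row_sum_delta; apply: eq_bigr => k _.
  by rewrite linearZ /= row_mxKr.
have -> : P c + \sum_k l ord0 k *: b k = psi (row_mx d l : rV_of NW).
  have -> : (row_mx d l : rV_of NW) = (lin_of inc_lin d) +
      \sum_(k < m) l ord0 k *: (row_mx 0 (delta_mx 0 k) : rV_of NW).
    exact: row_mxE.
  rewrite linearD linear_sum -dE; congr (_ + _).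
    by rewrite (psiE (d : rV_of NV)).
  by apply: eq_bigr => k _; rewrite linearZ.
have := psiN (row_mx d l : rV_of NW).
rewrite -[`|row_mx d l : rV_of NW|]/(nW (row_mx d l)) /nW row_mxKl row_mxKr dE.
case/andP => h1 ->; rewrite andbT; have [e1|/ltW e1] := leP eta 1.
  apply: le_trans h1.
  by rewrite ler_wpM2l ?subr_ge0 // lerDl mulr_ge0 ?l1norm_ge0 // ltW.
(* For [eta > 1] the lower bound is nonpositive. *)
by rewrite (@le_trans _ _ 0) // mulr_le0_ge0 ?ntype_ge0 // subr_le0.
Qed.

(** * Gluing two normed spaces along an approximate isometry *)

Section Amalgam.
Variables (R : realType) (X : lmodType R) (F G : normedModType R).
Variables (P : {linear X -> G}) (Q : {linear X -> F}) (rho : X -> R).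
Hypothesis rhoD : forall x y, rho (x + y) <= rho x + rho y.
Hypothesis rhoZ : forall (r : R) x, rho (r *: x) = `|r| * rho x.
Hypothesis PQ : forall x, `| `|P x| - `|Q x| | <= rho x.

(** The norm of [g + f] in the largest seminorm on the sum of [G] and [F] that
    is bounded by the given norms on [G] and [F], and by [rho x] at [P x - Q x].
    The hypothesis [PQ] says precisely that imposing the last bound does not
    shrink the norm of [G] or of [F], see [amalgam_l] and [amalgam_r]. *)
Definition amalgam (g : G) (f : F) : R :=
  inf (range (fun x => `|g + P x| + `|f - Q x| + rho x)).

Let rho_ge0 x : 0 <= rho x.
Proof. exact: le_trans (PQ x). Qed.

Lemma amalgam_le g f x : amalgam g f <= `|g + P x| + `|f - Q x| + rho x.
Proof.
apply: ge_inf; last by exists x.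
by exists 0 => _ [y _ <-]; rewrite !addr_ge0.
Qed.

Lemma le_amalgam g f (c : R) :
  (forall x, c <= `|g + P x| + `|f - Q x| + rho x) -> c <= amalgam g f.
Proof.
move=> h; apply: lb_le_inf.
  by exists (`|g + P 0| + `|f - Q 0| + rho 0), 0.
by move=> _ [x _ <-].
Qed.

Let rho0 : rho 0 = 0.
Proof. by rewrite -(scale0r 0) rhoZ normr0 mul0r. Qed.

Lemma amalgam_l g : amalgam g 0 = `|g|.
Proof.
apply/eqP; rewrite eq_le; apply/andP; split.
  apply: le_trans (amalgam_le _ _ 0) _.
  by rewrite rho0 !linear0 !addr0 normr0 !addr0.
apply: le_amalgam => x; rewrite sub0r normrN -addrA.
have -> : `|g| = `|(g + P x) - P x| by rewrite addrK.
apply: le_trans (ler_normB _ _) _; rewrite lerD2l -lerBlDl.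
exact: le_trans (ler_norm _) (PQ x).
Qed.

Lemma amalgam_r f : amalgam 0 f = `|f|.
Proof.
apply/eqP; rewrite eq_le; apply/andP; split.
  apply: le_trans (amalgam_le _ _ 0) _.
  by rewrite rho0 !linear0 !addr0 normr0 add0r.
apply: le_amalgam => x; rewrite add0r addrAC addrC.
have -> : `|f| = `|(f - Q x) + Q x| by rewrite subrK.
apply: le_trans (ler_normD _ _) _; rewrite lerD2l -lerBlDl.
by apply: le_trans (ler_norm _) _; rewrite distrC.
Qed.

Lemma amalgam_glue x : amalgam (P x) (- Q x) <= rho x.
Proof.
apply: le_trans (amalgam_le _ _ (- x)) _.
rewrite !linearN subrr opprK addNr !normr0 !add0r.
by rewrite -scaleN1r rhoZ normrN1 mul1r.
Qed.

Lemma amalgamD g f g' f' :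
  amalgam (g + g') (f + f') <= amalgam g f + amalgam g' f'.
Proof.
rewrite -lerBlDr; apply: le_amalgam => x; rewrite lerBlDr -lerBlDl.
apply: le_amalgam => y; rewrite lerBlDl.
apply: le_trans (amalgam_le _ _ (x + y)) _.
have -> : g + g' + P (x + y) = (g + P x) + (g' + P y).
  by rewrite linearD addrACA.
have -> : f + f' - Q (x + y) = (f - Q x) + (f' - Q y).
  by rewrite linearD opprD addrACA.
apply: le_trans (lerD (lerD (ler_normD _ _) (ler_normD _ _)) (rhoD _ _)) _.
by lra.
Qed.

Lemma amalgamZ (r : R) g f : amalgam (r *: g) (r *: f) = `|r| * amalgam g f.
Proof.
have [->|r0] := eqVneq r 0.
  by rewrite !scale0r amalgam_l !normr0 mul0r.
suff h (s : R) g' f' : s != 0 ->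
    amalgam (s *: g') (s *: f') <= `|s| * amalgam g' f'.
  apply/eqP; rewrite eq_le h //= mulrC -ler_pdivlMr ?normr_gt0 //.
  rewrite mulrC -normfV; have := h r^-1 (r *: g) (r *: f).
  by rewrite !scalerA mulVf // !scale1r; apply; rewrite invr_eq0.
move=> s0; rewrite mulrC -ler_pdivrMr ?normr_gt0 //.
apply: le_amalgam => x; rewrite ler_pdivrMr ?normr_gt0 //.
apply: le_trans (amalgam_le _ _ (s *: x)) _.
rewrite !linearZ -!scalerDr !normrZ rhoZ.
by lra.
Qed.

(** Where [rho] vanishes the two spaces are glued exactly: [P x] and [Q x]
    become the same vector. *)
Lemma amalgam_exact x f : rho x = 0 -> amalgam (P x) f = `|f + Q x|.
Proof.
move=> x0; apply/eqP; rewrite eq_le; apply/andP; split.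
  have := amalgamD (P x) (- Q x) 0 (f + Q x).
  rewrite addr0 amalgam_r addrC addrK => /le_trans; apply.
  by rewrite gerDr -x0 amalgam_glue.
have -> : `|f + Q x| = amalgam (P (- x) + P x) (- Q (- x) + f).
  by rewrite !linearN addNr opprK addrC amalgam_r.
apply: le_trans (amalgamD _ _ _ _) _; rewrite gerDr.
apply: le_trans (amalgam_glue _) _.
by rewrite -scaleN1r rhoZ x0 mulr0.
Qed.

(** Any tuple of [F], given by the map [L] that takes coefficients to
    combinations, gets a type over [G] from its position in the amalgam. *)
Section AmalgamType.
Variables (m : nat) (L : {linear 'rV[R]_m -> F}).

Definition amalgam_type_norm (u : G * 'rV[R]_m) : R := amalgam u.1 (L u.2).

Lemma amalgam_typeD u v :
  amalgam_type_norm (u + v) <= amalgam_type_norm u + amalgam_type_norm v.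
Proof. by rewrite /amalgam_type_norm /= linearD; apply: amalgamD. Qed.

Lemma amalgam_typeZ (r : R) u :
  amalgam_type_norm (r *: u) = `|r| * amalgam_type_norm u.
Proof. by rewrite /amalgam_type_norm /= linearZ; apply: amalgamZ. Qed.

Lemma amalgam_typeE g : amalgam_type_norm (g, 0) = `|g|.
Proof. by rewrite /amalgam_type_norm /= linear0 amalgam_l. Qed.

Definition amalgam_type : ntype G m :=
  NType amalgam_typeD amalgam_typeZ amalgam_typeE.

End AmalgamType.

End Amalgam.

(** * Moving a tuple of G to approximate a longer tuple of F *)

Section Comb.
Variables (R : pzRingType) (V : lmodType R) (a : nat -> V) (n : nat).

(** Tuples are initial segments of sequences, so that lengthening a tuple needs
    no cast. *)
Definition comb (l : 'rV[R]_n) : V := \sum_(j < n) l ord0 j *: a j.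

Lemma comb_is_linear : linear comb.
Proof.
move=> r u v; rewrite /comb scaler_sumr -big_split; apply: eq_bigr => j _.
by rewrite !mxE scalerDl scalerA.
Qed.

HB.instance Definition _ := GRing.isLinear.Build R _ V *:%R comb comb_is_linear.

Lemma comb_delta (j : 'I_n) : comb (delta_mx 0 j) = a j.
Proof.
rewrite /comb (bigD1 j) //= mxE !eqxx scale1r big1 ?addr0 // => l lj.
by rewrite mxE (negbTE lj) andbF scale0r.
Qed.

End Comb.

Section Step.
Variables (R : realType) (E F G : completeNormedModType R).
Variables (i : isoemb E F) (k : isoemb E G).

(** The formal vector [u] of [E(n)] evaluated at the first [n] terms of [a]; its
    norm is the value at [u] of the type of these terms over [E]. *)
Definition tuple_value (V : normedModType R) (h : isoemb E V) (a : nat -> V)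
    (n : nat) (u : E * 'rV[R]_n) : V := h u.1 + comb a u.2.

Lemma tuple_value_is_linear (V : normedModType R) (h : isoemb E V)
    (a : nat -> V) n :
  linear (tuple_value h a (n := n)).
Proof. by move=> r u v; rewrite /tuple_value /= !linearP scalerDr addrACA. Qed.

HB.instance Definition _ (V : normedModType R) (h : isoemb E V) a n :=
  GRing.isLinear.Build R _ V *:%R (tuple_value h a (n := n))
    (@tuple_value_is_linear V h a n).

(** Bounds the distance of the types of the two tuples by [r], without
    mentioning an ambient space in which both types would be realised. *)
Definition type_close (n : nat) (r : R) (a : nat -> F) (b : nat -> G) : Prop :=
  forall u : E * 'rV[R]_n,
    `| `|tuple_value k b u| - `|tuple_value i a u| | <= r * l1norm u.2.

Lemma small_factor (T : eqType) (s : seq T) (f : T -> R) (d : R) :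
    (forall u, 0 <= f u) -> 0 < d ->
  exists2 eta : R, 0 < eta & forall u, u \in s -> eta * f u < d.
Proof.
move=> f0 d0; have S0 : 0 <= \sum_(v <- s) f v by apply: sumr_ge0.
exists (d / (1 + \sum_(v <- s) f v)); first by rewrite divr_gt0 // ltr_pwDl.
move=> u us; rewrite mulrAC ltr_pdivrMr ?ltr_pwDl // ltr_pM2l //.
apply: (@le_lt_trans _ _ (\sum_(v <- s) f v)); last by rewrite ltrDr.
by rewrite (big_rem u) //= lerDl sumr_ge0.
Qed.

(** The amalgam of [F] and [G] is taken along [type_close]: elements of [E] are
    glued exactly, [a l] and [b l] up to [r] for [l < n]. Realising in [G] the
    type of [a] in this amalgam, approximately and over the finite-dimensional
    space spanned by the [b l] and by the elements of [E] that occur in [s],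
    gives [b']. *)
Lemma extend_approx (n m : nat) (r d : R) (a : nat -> F) (b : nat -> G)
    (s : seq (E * 'rV[R]_m)) :
    gurarij G -> (n <= m)%N -> 0 < r -> 0 < d -> type_close n r a b ->
  exists b' : nat -> G,
    (forall l, (l < n)%N -> `|b' l - b l| <= 2 * r) /\
    (forall u, u \in s ->
      `| `|tuple_value k b' u| - `|tuple_value i a u| | < d).
Proof.
move=> gG nm r0 d0 ab.
pose rho (u : E * 'rV[R]_n) := r * l1norm u.2.
have rhoD u v : rho (u + v) <= rho u + rho v.
  by rewrite /rho -mulrDr ler_wpM2l ?l1normD // ltW.
have rhoZ (c : R) u : rho (c *: u) = `|c| * rho u.
  by rewrite /rho l1normZ mulrCA.
pose xi : ntype G m := amalgam_type rhoD rhoZ ab (comb a (n := m)).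
pose e (j : nat) := (nth 0 s j).1.
(* Parametrises the part of [E(n)] that involves only the elements of [E] that
   occur in [s]. *)
pose c2x (c : 'rV[R]_(size s + n)) : E * 'rV[R]_n :=
  (comb e (lsubmx c), rsubmx c).
have c2x_lin : linear c2x.
  by move=> c u v; rewrite /c2x !linearP.
pose P : {linear 'rV[R]_(size s + n) -> G} :=
  tuple_value k b (n := n) \o lin_of c2x_lin.
(* At [u] the relative error [eta] costs at most [eta * (`|tuple_value i a u| +
   2 * l1norm u.2)], and at [a l - b l], of norm at most [r], it costs at most
   [eta * (r + 2)]. *)
have [eta eta0 etas] : exists2 eta : R, 0 < eta & [/\ eta <= 1,
    eta * (r + 2) <= r & forall u : E * 'rV[R]_m, u \in s ->
      eta * (`|tuple_value i a u| + 2 * l1norm u.2) < d].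
  have [u|eta eta0 etas] :=
    @small_factor _ s (fun u => `|tuple_value i a u| + 2 * l1norm u.2) d _ d0.
    by rewrite addr_ge0 // mulr_ge0 // l1norm_ge0.
  have r2 : 0 < r + 2 by rewrite addr_gt0.
  exists (Num.min (Num.min 1 (r / (r + 2))) eta).
    by rewrite !lt_min ltr01 eta0 divr_gt0.
  split; first by rewrite !ge_min lexx.
    by rewrite -ler_pdivlMr // !ge_min lexx orbT.
  move=> u us; apply: le_lt_trans (etas u us).
  by rewrite ler_wpM2r ?addr_ge0 ?mulr_ge0 ?l1norm_ge0 // ge_min lexx orbT.
have [eta1 etar etad] := etas.
have [b' b'P] := gurarij_approx xi P gG eta0.
exists (fun l => if insub l is Some j then b' j else 0).
have b'E l : comb (fun l => if insub l is Some j then b' j else 0) l =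
    \sum_(j < m) l ord0 j *: b' j.
  by apply: eq_bigr => j _; rewrite valK.
split=> [l ln|u us].
  (* The vector [- b l + a l] of the amalgam has norm at most [r]. *)
  pose j := Ordinal ln; pose j' := Ordinal (leq_trans ln nm).
  have oN (V : normedModType R) (h : isoemb E V) c :
      tuple_value h c (0, - delta_mx 0 j) = - c l.
    by rewrite /tuple_value /= linear0 add0r linearN /= comb_delta.
  have := b'P (row_mx 0 (- delta_mx 0 j)) (delta_mx 0 j').
  rewrite -b'E comb_delta l1norm_delta mulr1.
  have PE : lin_of c2x_lin (row_mx 0 (- delta_mx 0 j)) = (0, - delta_mx 0 j).
    by rewrite /lin_of /c2x row_mxKl row_mxKr linear0.
  have -> : P (row_mx 0 (- delta_mx 0 j)) = - b l.
    by rewrite /= PE oN.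
  rewrite [- b l + _]addrC => /andP[_ /le_trans]; apply.
  have : xi (- b l, delta_mx 0 j') <= r.
    have := amalgam_glue rhoZ ab (0, - delta_mx 0 j).
    rewrite /rho /= -scaleN1r l1normZ normrN1 l1norm_delta !mulr1 scaleN1r.
    rewrite !oN opprK => h; apply: le_trans h.
    by rewrite /xi /= /amalgam_type_norm /= comb_delta.
  have : 0 <= xi (- b l, delta_mx 0 j') by exact: ntype_ge0.
  move: (xi _) => x x0 xr; nra.
have [j js uj] : exists2 j, (j < size s)%N & nth 0 s j = u.
  by exists (index u s); rewrite ?index_mem ?nth_index.
have := b'P (row_mx (delta_mx 0 (Ordinal js)) 0) u.2.
have PE : lin_of c2x_lin (row_mx (delta_mx 0 (Ordinal js)) 0) = (u.1, 0).
  by rewrite /lin_of /c2x row_mxKl row_mxKr comb_delta /e uj.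
have -> : P (row_mx (delta_mx 0 (Ordinal js)) 0) = k u.1.
  by rewrite /= PE /tuple_value /= linear0 addr0.
have -> : xi (k u.1, u.2) = `|tuple_value i a u|.
  have := @amalgam_exact _ _ _ _ _ _ _ rhoD rhoZ ab (u.1, 0) (comb a u.2).
  rewrite /rho /= l1norm0 mulr0 /tuple_value /= !linear0 !addr0 addrC; apply.
  by [].
rewrite -b'E -/(tuple_value k _ u) => /andP[h1 h2].
have := etad u us; have := l1norm_ge0 u.2.
have := normr_ge0 (tuple_value i a u).
move: h1 h2.
move: `|tuple_value i a u| (l1norm u.2) `|tuple_value k _ u| => x y z.
move=> h1 h2 x0 y0 h.
have ex0 : 0 <= eta * x by rewrite mulr_ge0 // ltW.
have ey0 : 0 <= eta * y by rewrite mulr_ge0 // ltW.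
have eey : eta * (eta * y) <= eta * y by rewrite ler_piMl.
by rewrite ltr_norml; apply/andP; split; lra.
Qed.

End Step.

(** * Isolated types *)

Section TypeTopology.
Variables (R : realType) (E : completeNormedModType R) (n : nat).

Definition finite_nbhs (xi : ntype E n) : set_system (ntype E n) :=
  [set A | exists (s : seq (E * 'rV[R]_n)) (d : R), 0 < d /\
    forall zeta : ntype E n, (forall u, u \in s -> `|zeta u - xi u| < d) ->
      A zeta].

Lemma finite_nbhs_filter xi : Filter (finite_nbhs xi).
Proof.
constructor.
- by exists [::], 1.
- move=> A B [s [d [d0 sA]]] [t [e [e0 tB]]].
  exists (s ++ t), (Num.min d e); split; first by rewrite lt_min d0.
  move=> zeta h; split; [apply: sA|apply: tB] => u us.
    have := h u; rewrite mem_cat us => /(_ isT).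
    by rewrite lt_min => /andP[].
  have := h u; rewrite mem_cat us orbT => /(_ isT).
  by rewrite lt_min => /andP[].
- move=> A B AB [s [d [d0 sA]]]; exists s, d; split => // zeta h.
  exact/AB/sA.
Qed.

(** The sets of [finite_nbhs xi] form a filter for which every evaluation
    converges to its value at [xi], so this filter converges to [xi] in the
    least topology that makes the evaluations continuous. *)
Lemma nbhs_finite (xi : ntype E n) (A : set (ntype E n)) :
  nbhs xi A -> finite_nbhs xi A.
Proof.
have FF := finite_nbhs_filter xi.
suff : finite_nbhs xi --> xi by apply.
apply/cvg_sup => u B [_ [[U oU <-] /= Uxi UB]].
have /nbhs_ballP[d /= d0 dU] : nbhs (xi u) U by apply: open_nbhs_nbhs.
exists [:: u], d; split => // zeta h; apply/UB/dU.
by rewrite -ball_normE /= distrC h // mem_head.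
Qed.

(** In a common realisation the values at [u] differ by the combination of the
    [a k - b k] with coefficients [u.2]. *)
Lemma type_dist_le (xi zeta : ntype E n) (r : R) :
  (type_dist xi zeta < r%:E)%E ->
  forall u, `|xi u - zeta u| <= r * l1norm u.2.
Proof.
move=> /ereal_inf_lt[_ [F [i [a [b [-> -> ->]]]]]].
rewrite lte_fin => /ltW abr u; rewrite /= /tp_norm.
apply: le_trans (ler_dist_dist _ _) _.
rewrite opprD addrACA subrr add0r -sumrB mulr_sumr.
apply: le_trans (ler_norm_sum _ _ _) _; apply: ler_sum => l _.
rewrite -scalerBr normrZ mulrC ler_wpM2r //; apply: le_trans abr.
exact: le_bigmax.
Qed.

End TypeTopology.

(** What isolation of the type of [a] provides: finitely many approximate
    equalities of norms imply the uniform estimate of [type_close]. *)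
Lemma atomic_approx (R : realType) (E F G : completeNormedModType R)
    (i : isoemb E F) (k : isoemb E G) (n : nat) (a : nat -> F) (r : R) :
  atomic_over i -> 0 < r ->
  exists (s : seq (E * 'rV[R]_n)) (d : R), 0 < d /\ forall b : nat -> G,
    (forall u, u \in s ->
      `| `|tuple_value k b u| - `|tuple_value i a u| | < d) ->
    type_close i k n r a b.
Proof.
move=> ati r0.
pose xi := tp i (fun l : 'I_n => a l).
have : nbhs xi [set zeta | (type_dist xi zeta < r%:E)%E].
  by apply: ati; exists r.
move=> /nbhs_finite[s [d [d0 sd]]]; exists s, d; split => // b h u.
have /type_dist_le /(_ u) := sd (tp k (fun l : 'I_n => b l)) h.
by rewrite distrC.
Qed.

(** * Isometries defined on a dense subspace *)

Section IsometricExtension.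
Variables (R : realType) (F : normedModType R) (G : completeNormedModType R).
(* The graph of a linear isometry defined on a subspace. A relation is more
   convenient than a function: in the application a vector has many
   representations as a combination, and the choice of one is not linear. *)
Variable Gam : F -> G -> Prop.
Hypothesis GamP : forall (r : R) x y x' y', Gam x y -> Gam x' y' ->
  Gam (r *: x + x') (r *: y + y').
Hypothesis Gam_norm : forall x y, Gam x y -> `|y| = `|x|.
Hypothesis Gam_dense : forall x (e : R), 0 < e ->
  exists x' y', Gam x' y' /\ `|x - x'| < e.

Definition graph_closure (x : F) (y : G) : Prop := forall e : R, 0 < e ->
  exists x' y', [/\ Gam x' y', `|x - x'| < e & `|y - y'| < e].

Lemma graph_closureP (r : R) x y x' y' :
  graph_closure x y -> graph_closure x' y' ->
  graph_closure (r *: x + x') (r *: y + y').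
Proof.
move=> xy xy' e e0.
have r1 : 0 < `|r| + 1 by rewrite ltr_wpDl.
have e20 : 0 < e / 2 by rewrite divr_gt0.
have er0 : 0 < e / 2 / (`|r| + 1) by rewrite divr_gt0.
have [u [v [uv xu yv]]] := xy _ er0.
have [u' [v' [uv' xu' yv']]] := xy' _ e20.
have aux (V : normedModType R) (z z' w w' : V) :
    `|z - w| < e / 2 / (`|r| + 1) -> `|z' - w'| < e / 2 ->
    `|r *: z + z' - (r *: w + w')| < e.
  rewrite ltr_pdivlMr // => h h'.
  have -> : r *: z + z' - (r *: w + w') = r *: (z - w) + (z' - w').
    by rewrite scalerBr opprD addrACA.
  apply: le_lt_trans (ler_normD _ _) _; rewrite (splitr e) normrZ.
  apply: ler_ltD => //; apply: le_trans (ltW h).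
  by rewrite mulrC ler_wpM2l // lerDl.
exists (r *: u + u'), (r *: v + v'); split; [exact: GamP|exact: aux|exact: aux].
Qed.

Lemma graph_closure_norm x y : graph_closure x y -> `|y| = `|x|.
Proof.
move=> xy; apply/eqP; rewrite -subr_eq0 -normr_le0.
apply/ler_addgt0Pr => e e0; rewrite add0r.
have [|u [v [/Gam_norm uv xu yv]]] := xy (e / 2); first by rewrite divr_gt0.
have -> : `|y| - `|x| = (`|y| - `|v|) - (`|x| - `|u|) by rewrite uv; lra.
apply: le_trans (ler_normB _ _) _; rewrite (splitr e) lerD //.
  by apply: le_trans (ler_dist_dist _ _) _; apply: ltW.
by apply: le_trans (ler_dist_dist _ _) _; apply: ltW.
Qed.

Lemma graph_closure_unique x y y' :
  graph_closure x y -> graph_closure x y' -> y = y'.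
Proof.
move=> xy xy'; have := graph_closureP (-1) xy' xy.
move=> /graph_closure_norm; rewrite !scaleN1r addNr normr0 => /normr0_eq0.
by rewrite addrC => /subr0_eq.
Qed.

(** Picking a partner [f u] for each [u] in the domain gives a 1-Lipschitz map,
    which sends the trace of the neighbourhoods of [x] on the domain to a Cauchy
    filter. *)
Lemma graph_closure_total x : exists y, graph_closure x y.
Proof.
pose D : set F := [set u | exists v, Gam u v].
have ex u : exists v, D u -> Gam u v.
  by have [[v uv]|n] := pselect (D u); [exists v|exists 0].
have [f fP] := choice ex.
have clx : closure D x.
  move=> B /nbhs_ballP[e /= e0 xB]; have [u [v [uv xu]]] := Gam_dense x e0.
  by exists u; split; [exists v|apply: xB; rewrite -ball_normE].
have FF : ProperFilter (within D (nbhs x)) by apply: within_nbhs_proper.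
have Fx : within D (nbhs x) --> x by apply: cvg_within.
have FD : within D (nbhs x) D by rewrite /within /=; near=> y.
have cF : cauchy (within D (nbhs x)) by apply: cvg_cauchy; exact: cvgP Fx.
have cf : cauchy (f @ within D (nbhs x)).
  apply: (@lipschitz_cauchy _ _ _ f _ 1 _ FF cF FD) => u u' /fP Du /fP Du'.
  have := GamP (-1) Du' Du; rewrite mul1r => /Gam_norm.
  by rewrite !scaleN1r addrC [- u' + _]addrC => ->.
have /cvg_ex[y fy] : cvg (f @ within D (nbhs x)) by apply: cauchy_cvg.
exists y => e e0.
have Fx' : \forall u \near within D (nbhs x), `|x - u| < e.
  by have := Fx _ (nbhsx_ballx x e e0); rewrite -ball_normE.
have Fy' : \forall u \near within D (nbhs x), `|y - f u| < e.
  by have := fy _ (nbhsx_ballx y e e0); rewrite -ball_normE.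
have [u [[xu yu] Du]] := filter_ex (filterI (filterI Fx' Fy') FD).
by exists u, (f u); split => //; apply: fP.
Unshelve. all: by end_near. Qed.

Lemma isometric_extension :
  exists psi : isoemb F G, forall x y, Gam x y -> psi x = y.
Proof.
have [psi psiP] := choice graph_closure_total.
have psi_lin : linear psi.
  move=> r x x'; apply: graph_closure_unique (psiP _) _.
  by apply: graph_closureP.
have psi_norm x : `|lin_of psi_lin x| = `|x|.
  exact: graph_closure_norm (psiP x).
exists (IsoEmb psi_norm) => x y xy.
apply: graph_closure_unique (psiP x) _ => e e0.
by exists x, y; split => //; rewrite subrr normr0.
Qed.

End IsometricExtension.

(** * Approximating sequences and their limits *)

Lemma separable_sequence (R : realType) (V : normedModType R) :
  separable_space V ->
  exists d : nat -> V, forall x (e : R), 0 < e -> exists l, `|x - d l| < e.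
Proof.
move=> [D /countable_injP[f finj] Ddense].
have ex l : exists x, (exists2 y, D y & f y = l) -> D x /\ f x = l.
  have [[y Dy yl]|n] := pselect (exists2 y, D y & f y = l); first by exists y.
  by exists 0.
have [d dP] := choice ex; exists d => x e e0.
have [|y [xy Dy]] := Ddense (ball x e) _ (ball_open x e).
  by exists x; apply: ballxx.
have [|Dd fd] := dP (f y); first by exists y.
exists (f y); have -> : d (f y) = y by apply: finj; rewrite ?inE.
by move: xy; rewrite -ball_normE.
Qed.

Lemma geometric_small (R : realType) (C e : R) : 0 < e ->
  exists m0, forall m, (m0 <= m)%N -> C / 2 ^+ m < e.
Proof.
move=> e0; exists (Num.Def.archi_bound (C / e)) => m mC.
rewrite ltr_pdivrMr ?exprn_gt0 // mulrC -ltr_pdivrMr //.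
exact: upper_nthrootP.
Qed.

Section Iteration.
Variables (R : realType) (E F G : completeNormedModType R).
Variables (i : isoemb E F) (k : isoemb E G).

(** Padding coefficients with zeros, to compare combinations of different
    lengths. *)
Lemma pad_combination (n m : nat) (u : E * 'rV[R]_n) : (n <= m)%N ->
  exists2 u' : E * 'rV[R]_m, l1norm u'.2 = l1norm u.2 &
    forall (V : normedModType R) (h : isoemb E V) (a : nat -> V),
      tuple_value h a u' = tuple_value h a u.
Proof.
move=> nm; rewrite -(subnKC nm).
exists (u.1, row_mx u.2 0).
  rewrite /l1norm big_split_ord /= [X in _ + X]big1 ?addr0.
    by apply: eq_bigr => j _; rewrite row_mxEl.
  by move=> j _; rewrite row_mxEr mxE normr0.
move=> V h a; rewrite /tuple_value /comb big_split_ord /=.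
rewrite [X in _ + (_ + X)]big1 ?addr0.
  by congr (_ + _); apply: eq_bigr => j _; rewrite row_mxEl.
by move=> j _; rewrite row_mxEr mxE scale0r.
Qed.

Lemma type_close_le (n m : nat) (r : R) (a : nat -> F) (b : nat -> G) :
  (n <= m)%N -> type_close i k m r a b -> type_close i k n r a b.
Proof.
move=> nm h u; have [u' <- uE] := pad_combination u nm.
by rewrite -!uE; apply: h.
Qed.

Lemma extend_type_close (n m : nat) (r r' : R) (a : nat -> F) (b : nat -> G) :
    atomic_over i -> gurarij G -> (n <= m)%N -> 0 < r -> 0 < r' ->
    type_close i k n r a b ->
  exists b' : nat -> G, type_close i k m r' a b' /\
    (forall l, (l < n)%N -> `|b' l - b l| <= 2 * r).
Proof.
move=> ati gG nm r0 r'0 ab.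
have [s [d [d0 sd]]] := atomic_approx k m a ati r'0.
have [b' [bb' sb']] := extend_approx s gG nm r0 d0 ab.
by exists b'; split => //; apply: sd.
Qed.

Lemma approximating_sequence (n : nat) (r : R) (a : nat -> F) (b : nat -> G) :
    atomic_over i -> gurarij G -> 0 < r -> type_close i k n r a b ->
  exists bs : nat -> nat -> G, bs 0 = b /\
    forall m, type_close i k (n + m) (r / 2 ^+ m) a (bs m) /\
      forall l, (l < n + m)%N -> `|bs m.+1 l - bs m l| <= 2 * (r / 2 ^+ m).
Proof.
move=> ati gG r0 ab.
have rm0 m : 0 < r / 2 ^+ m by rewrite divr_gt0 // exprn_gt0.
have ex (mb : nat * (nat -> G)) : exists b' : nat -> G,
    type_close i k (n + mb.1) (r / 2 ^+ mb.1) a mb.2 ->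
    type_close i k (n + mb.1.+1) (r / 2 ^+ mb.1.+1) a b' /\
    (forall l, (l < n + mb.1)%N -> `|b' l - mb.2 l| <= 2 * (r / 2 ^+ mb.1)).
  have [c|nc] := pselect (type_close i k (n + mb.1) (r / 2 ^+ mb.1) a mb.2).
    have nn : (n + mb.1 <= n + mb.1.+1)%N by rewrite leq_add2l.
    by have [b' b'P] :=
      extend_type_close ati gG nn (rm0 mb.1) (rm0 mb.1.+1) c; exists b'.
  by exists mb.2.
have [f fP] := choice ex.
pose bs := fix bs m := if m is m'.+1 then f (m', bs m') else b.
have bsP m : type_close i k (n + m) (r / 2 ^+ m) a (bs m).
  elim: m => [|m IH]; first by rewrite addn0 expr0 divr1.
  by have [] := fP (m, bs m) IH.
exists bs; split => // m; split => //.
by have [] := fP (m, bs m) (bsP m).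
Qed.

(** The constant is [4 = \sum_m 2 / 2 ^+ m], the total displacement allowed
    after step [0], in units of [r]. *)
Lemma limit_sequence (n : nat) (r : R) (bs : nat -> nat -> G) :
  (forall m l, (l < n + m)%N -> `|bs m.+1 l - bs m l| <= 2 * (r / 2 ^+ m)) ->
  0 < r ->
  exists b : nat -> G,
    forall m l, (l < n + m)%N -> `|b l - bs m l| <= 4 * r / 2 ^+ m.
Proof.
move=> bsP r0.
(* The difference on the right is the tail of the geometric series between the
   steps [m] and [m + p]. *)
have tel m p l : (l < n + m)%N ->
    `|bs (m + p)%N l - bs m l| <= 4 * r / 2 ^+ m - 4 * r / 2 ^+ (m + p).
  move=> lm; elim: p => [|p IH]; first by rewrite addn0 !subrr normr0.
  have lmp : (l < n + (m + p))%N by rewrite addnA ltn_addr.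
  have -> : bs (m + p.+1)%N l - bs m l =
      (bs (m + p).+1 l - bs (m + p)%N l) + (bs (m + p)%N l - bs m l).
    by rewrite addnS addrA subrK.
  apply: le_trans (ler_normD _ _) _; apply: le_trans (lerD (bsP _ _ lmp) IH) _.
  have -> : 2 * (r / 2 ^+ (m + p)) = 2 * (2 * r / 2 ^+ (m + p).+1).
    by rewrite exprS; field; rewrite expf_neq0.
  have -> : 4 * r / 2 ^+ (m + p) = 2 * (4 * r / 2 ^+ (m + p).+1).
    by rewrite exprS; field; rewrite expf_neq0.
  by rewrite addnS; lra.
have bnd m l : (l < n + m)%N -> forall m', (m <= m')%N ->
    `|bs m' l - bs m l| <= 4 * r / 2 ^+ m.
  move=> lm m' mm'; rewrite -(subnKC mm'); apply: le_trans (tel _ _ _ lm) _.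
  by rewrite gerBl divr_ge0 ?exprn_ge0 // mulr_ge0 // ltW.
(* The estimates concern the coordinate [l] only once [l < n + m]. *)
have cv l : cvg ((fun m => bs m l) @ \oo).
  apply: cauchy_cvg; apply/cauchy_exP => e e0.
  have [m0 m0P] := geometric_small (4 * r) e0.
  have lm : (l < n + (maxn l.+1 m0))%N.
    by rewrite ltn_addl // leq_max leqnn.
  exists (bs (maxn l.+1 m0) l); exists (maxn l.+1 m0) => // m' /= mm'.
  rewrite -ball_normE /= distrC.
  by apply: le_lt_trans (bnd _ _ lm _ mm') _; apply: m0P; rewrite leq_maxr.
exists (fun l => lim ((fun m => bs m l) @ \oo)) => m l lm.
apply/ler_addgt0Pr => e e0.
have /cvgrPdist_le /(_ _ e0)[m1 _ m1P] := cv l.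
have := m1P (maxn m m1) (leq_maxr _ _).
have := bnd _ _ lm _ (leq_maxl m m1).
move=> h1 h2; apply: le_trans (ler_distD (bs (maxn m m1) l) _ _) _.
by rewrite [leRHS]addrC lerD.
Qed.

(** At step [m] the two norms differ by at most [r / 2 ^+ m] for the
    approximation, plus [4 * r / 2 ^+ m] for its distance to the limit, times
    [l1norm u.2]. *)
Lemma limit_isometry (n : nat) (r : R) (a : nat -> F) (bs : nat -> nat -> G)
    (b : nat -> G) :
    (forall m, type_close i k (n + m) (r / 2 ^+ m) a (bs m)) ->
    (forall m l, (l < n + m)%N -> `|b l - bs m l| <= 4 * r / 2 ^+ m) ->
  forall p (u : E * 'rV[R]_p), `|tuple_value k b u| = `|tuple_value i a u|.
Proof.
move=> bsP bbs p u; apply/eqP; rewrite -subr_eq0 -normr_le0.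
apply/ler_addgt0Pr => e e0; rewrite add0r.
have [m0 m0P] := geometric_small (5 * r * l1norm u.2) e0.
set m := maxn p m0.
have pm : (p <= n + m)%N.
  by apply: leq_trans (leq_addl _ _); rewrite leq_maxl.
have h1 := type_close_le pm (bsP m) u.
have h2 : `|tuple_value k b u - tuple_value k (bs m) u| <=
    4 * r / 2 ^+ m * l1norm u.2.
  rewrite /tuple_value opprD addrACA subrr add0r -sumrB mulr_sumr.
  apply: le_trans (ler_norm_sum _ _ _) _; apply: ler_sum => l _.
  rewrite -scalerBr normrZ mulrC ler_wpM2r // bbs //.
  exact: leq_trans (ltn_ord l) pm.
apply: ltW; apply: le_lt_trans (m0P m (leq_maxr _ _)).
have h3 := ler_dist_dist (tuple_value k b u) (tuple_value k (bs m) u).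
apply: le_trans (ler_distD `|tuple_value k (bs m) u| _ _) _.
apply: le_trans (lerD (le_trans h3 h2) h1) _.
by rewrite -mulrDl -!mulrA; lra.
Qed.

End Iteration.

(** The form of the theorem from which both halves follow: the initial data are
    an exact copy [b0] in [G] of a finite tuple [a0] of [F]. *)
Lemma atomic_embedding (R : realType) (E F G : completeNormedModType R)
    (i : isoemb E F) (k : isoemb E G) (n : nat) (a0 : nat -> F) (b0 : nat -> G)
    (e : R) :
    separable_space F -> atomic_over i -> gurarij G -> 0 < e ->
    (forall u : E * 'rV[R]_n, `|tuple_value k b0 u| = `|tuple_value i a0 u|) ->
  exists psi : isoemb F G, (forall x, psi (i x) = k x) /\
    forall l, (l < n)%N -> `|psi (a0 l) - b0 l| <= e.
Proof.
move=> sepF ati gG e0 ab0.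
have [d dP] := separable_sequence sepF.
(* The given tuple, followed by a dense sequence. *)
pose a l := if (l < n)%N then a0 l else d (l - n)%N.
have aE (u : E * 'rV[R]_n) : tuple_value i a u = tuple_value i a0 u.
  by congr (_ + _); apply: eq_bigr => j _; rewrite /a ltn_ord.
have e40 : 0 < e / 4 by rewrite divr_gt0.
have close0 : type_close i k n (e / 4) a b0.
  by move=> u; rewrite aE ab0 subrr normr0 mulr_ge0 ?l1norm_ge0 // ltW.
have [bs [bs0 bsP]] := approximating_sequence ati gG e40 close0.
have [b bP] := limit_sequence (fun m => (bsP m).2) e40.
have iso := limit_isometry (fun m => (bsP m).1) bP.
pose Gam x y := exists p (u : E * 'rV[R]_p),
  x = tuple_value i a u /\ y = tuple_value k b u.
have [||| psi psiP] := @isometric_extension _ _ _ Gam.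
- move=> r _ _ _ _ [p [u [-> ->]]] [q [v [-> ->]]].
  have [u' _ uE] := pad_combination u (leq_addr q p).
  have [v' _ vE] := pad_combination v (leq_addl p q).
  by exists (p + q)%N, (r *: u' + v'); rewrite !linearP /= !uE !vE.
- by move=> _ _ [p [u [-> ->]]].
- move=> x eps eps0; have [l xl] := dP x _ eps0.
  exists (a (n + l)%N), (b (n + l)%N); split; last first.
    by rewrite /a ltnNge leq_addr addKn.
  exists (n + l).+1, (0, delta_mx 0 ord_max).
  by rewrite /tuple_value !linear0 !add0r !(comb_delta _ ord_max).
exists psi; split=> [x|l ln].
  apply: psiP; exists 0, (x, 0).
  by rewrite /tuple_value /= !linear0 !addr0.
have -> : psi (a0 l) = b l.
  apply: psiP; exists l.+1, (0, delta_mx 0 ord_max).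
  by rewrite /tuple_value !linear0 !add0r !(comb_delta _ ord_max) /a /= ln.
have := bP 0 l; rewrite addn0 bs0 expr0 divr1 => /(_ ln) /le_trans; apply.
by lra.
Qed.

(** * The embedding theorem *)

(** As [E] is complete, its image is a complete subspace, to which finitely many
    vectors are added. *)
Lemma finite_codimensional_coef (R : realType) (E F : completeNormedModType R)
    (i : isoemb E F) : finite_codimensional i ->
  exists (n : nat) (a : nat -> F) (C : R), 0 <= C /\ forall y : F,
    exists2 u : E * 'rV[R]_n,
      y = tuple_value i a u & forall l, `|u.2 ord0 l| <= C * `|y|.
Proof.
move=> [n [a' a'P]].
pose a l := if insub l is Some j then a' j else 0.
have [si ci] := complete_range i.
have [_ _ [C C0 HC]] := complete_span_sum a n si ci.
exists n, a, C; split => // y.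
have [|c [x _ xE] cC] := HC y.
  have [x [c yE]] := a'P y.
  apply: (@span_sumI _ _ _ _ _ _
    (fun l => if insub l is Some j then c j else 0)).
  exists x => //; rewrite yE.
  suff -> : \sum_(l < n) c l *: a' l = \sum_(l < n)
      (if insub (l : nat) is Some j then c j else 0) *: a l by rewrite addrK.
  by apply: eq_bigr => l _; rewrite /a valK.
exists (x, \row_(l < n) c l).
  rewrite /tuple_value /comb /= xE.
  under [X in _ = _ + X]eq_bigr do rewrite mxE.
  by rewrite subrK.
by move=> l; rewrite mxE cC.
Qed.

Lemma opnorm_le (R : realType) (E F : normedModType R) (f : E -> F) (c : R) :
  (forall x, `|x| <= 1 -> `|f x| <= c) -> (opnorm f <= c%:E)%E.
Proof.
by move=> h; apply: ge_ereal_sup => _ [x /= x1 <-]; rewrite lee_fin h.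
Qed.

Theorem theorem2p5 (R : realType) :
  (forall (E F0 F1 G : completeNormedModType R)
     (i : isoemb E F0) (j : isoemb F0 F1) (k : isoemb E G)
     (phi : isoemb F0 G),
     finite_codimensional i ->
     separable_space F1 ->
     atomic_over (isoemb_comp j i) ->
     gurarij G ->
     (forall x : E, phi (i x) = k x) ->
     forall eps : R, 0 < eps ->
     exists psi : isoemb F1 G,
       (forall x : E, psi (j (i x)) = k x) /\
       (opnorm (fun y : F0 => (psi (j y) - phi y)%R) < eps%:E)%E) /\
  (forall (E F G : completeNormedModType R) (i : isoemb E F) (k : isoemb E G),
     separable_space F ->
     atomic_over i ->
     gurarij G ->
     exists psi : isoemb F G, forall x : E, psi (i x) = k x).
Proof.
split=> [E F0 F1 G i j k phi fin sepF ati gG phik eps eps0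
  |E F G i k sepF ati gG].
  have [n [a [C [C0 aC]]]] := finite_codimensional_coef fin.
  (* Moving each of the [n] spanning vectors by at most [eps / 2 / (1 + n%:R *
     C)] moves a vector of norm at most [1], whose coefficients are at most [C],
     by at most [eps / 2]. *)
  have d0 : 0 < 1 + n%:R * C by rewrite ltr_pwDl // mulr_ge0.
  have e0 : 0 < eps / 2 / (1 + n%:R * C) by rewrite !divr_gt0.
  have overE (V : normedModType R) (h : isoemb F0 V) (h' : isoemb E V) u :
      (forall x, h' x = h (i x)) ->
      tuple_value h' (h \o a) u = h (tuple_value i a (n := n) u).
    move=> hE; rewrite /tuple_value linearD linear_sum hE; congr (_ + _).
    by apply: eq_bigr => l _; rewrite linearZ.
  have [|psi [psik psia]] := @atomic_embedding _ _ _ _ (isoemb_comp j i) k n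
      (j \o a) (phi \o a) _ sepF ati gG e0.
    by move=> u; rewrite !overE // !isoemb_norm.
  exists psi; split => //.
  apply: (@le_lt_trans _ _ (eps / 2)%:E); last by rewrite lte_fin; lra.
  apply: opnorm_le => y y1; have [u yE uC] := aC y.
  have -> : psi (j y) - phi y =
      \sum_(l < n) u.2 ord0 l *: (psi (j (a l)) - phi (a l)).
    rewrite {1 2}yE /tuple_value !linearD psik phik addrACA subrr add0r.
    rewrite !linear_sum -big_split; apply: eq_bigr => l _.
    by rewrite scalerDr !linearZ.
  apply: le_trans (ler_norm_sum _ _ _) _.
  apply: (@le_trans _ _ (\sum_(l < n) C * (eps / 2 / (1 + n%:R * C)))).
    apply: ler_sum => l _; rewrite normrZ ler_pM // ?psia //.
    by apply: le_trans (uC l) _; rewrite ler_piMr.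
  rewrite sumr_const card_ord -[leLHS]mulr_natl [leLHS]mulrA mulrCA ler_piMr //.
    by rewrite divr_ge0 // ltW.
  by rewrite ler_pdivrMr // mul1r lerDr.
have [|psi [psik _]] := @atomic_embedding _ _ _ _ i k 0 0 0 1 sepF ati gG ltr01.
  by move=> u; rewrite /tuple_value /comb !big_ord0 !addr0 !isoemb_norm.
by exists psi.
Qed.
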